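(* Let $\mathbf{x} \sim \mathcal{N}_n(\boldsymbol{\mu},\boldsymbol{\Sigma})$ with $\boldsymbol{\Sigma}$ positive definite, let $\mathcal{X}^{0:M}$ be a hierarchical partition of the elements of $\mathbf{x}$, and let $\hat p(\mathbf{x}) = \prod_{m=0}^M \prod_{j_1,\ldots,j_m} p(\mathcal{X}_{j_1,\ldots,j_m} \mid \mathcal{A}_{j_1,\ldots,j_m})$ be the corresponding hierarchical Vecchia (HV) approximation, with conditioning sets $\mathcal{C}_i$, $i=1,\ldots,n$. Then $\hat p$ is the density of a multivariate normal distribution with mean $\boldsymbol{\mu}$: $\hat p(\mathbf{x}) = \mathcal{N}_n(\mathbf{x} \mid \boldsymbol{\mu}, \hat{\boldsymbol{\Sigma}})$ for some covariance matrix $\hat{\boldsymbol{\Sigma}}$. Define $\mathbf{L} = \mathrm{chol}(\hat{\boldsymbol{\Sigma}})$ and $\mathbf{U} = \mathrm{rchol}(\hat{\boldsymbol{\Sigma}}^{-1}) = \mathbf{P}\,\mathrm{chol}(\mathbf{P}\hat{\boldsymbol{\Sigma}}^{-1}\mathbf{P})\,\mathbf{P}$, where $\mathbf{P}$ is the reverse-ordering permutation matrix. Then: (1) For all $i \neq j$: (a) $\mathbf{L}_{i,j} = 0$ unless $x_j \in \mathcal{C}_i$; (b) $\mathbf{U}_{j,i} = 0$ unless $x_j \in \mathcal{C}_i$. (2) $\mathbf{U} = \mathbf{L}^{-\top}$.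
   Context: Matrix notation: for a symmetric positive-definite matrix $\mathbf{A}$, $\mathrm{chol}(\mathbf{A})$ is the unique lower-triangular matrix $\mathbf{B}$ with positive diagonal and $\mathbf{B}\mathbf{B}^\top=\mathbf{A}$; $\mathbf{P}$ is the $n\times n$ matrix with $\mathbf{P}_{i,n+1-i}=1$ and zeros elsewhere; $\mathbf{L}^{-\top} = (\mathbf{L}^{-1})^\top$. $\mathcal{N}_n(\mathbf{x}\mid\boldsymbol\mu,\boldsymbol\Sigma)$ is the $n$-variate normal density evaluated at $\mathbf{x}$. Hierarchical partition: let $\mathbf{x}=(x_1,\ldots,x_n)^\top$, $M\ge 0$ and $J_1,\ldots,J_M\ge 1$. The elements of $\mathbf{x}$ are partitioned into pairwise disjoint sets $\mathcal{X}_{j_1,\ldots,j_m}$, indexed by $m\in\{0,\ldots,M\}$ and $j_k\in\{1,\ldots,J_k\}$ for $k=1,\ldots,m$ (for $m=0$ there is a single set, written $\mathcal{X}$). Level $m$ is $\mathcal{X}^0=\mathcal{X}$ and $\mathcal{X}^m=\bigcup_{j_1=1}^{J_1}\cdots\bigcup_{j_m=1}^{J_m}\mathcal{X}_{j_1,\ldots,j_m}$ for $m\ge1$; $\mathcal{X}^{0:m}=\bigcup_{k=0}^m\mathcal{X}^k$, and $\mathcal{X}^{0:M}$ consists of all elements of $\mathbf{x}$. The ordering of $\mathbf{x}$ is compatible with the levels: if $i>j$, $x_i\in\mathcal{X}^{m_1}$ and $x_j\in\mathcal{X}^{m_2}$, then $m_1\ge m_2$. Ancestors and HV approximation: the ancestor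 set of $\mathcal{X}_{j_1,\ldots,j_m}$ is $\mathcal{A}_{j_1,\ldots,j_m}=\mathcal{X}\cup\mathcal{X}_{j_1}\cup\mathcal{X}_{j_1,j_2}\cup\cdots\cup\mathcal{X}_{j_1,\ldots,j_{m-1}}$ (empty for $m=0$). With $p$ denoting (conditional) densities under the exact distribution $\mathcal{N}_n(\boldsymbol{\mu},\boldsymbol{\Sigma})$, the HV approximation is the density $\hat p(\mathbf{x})=\prod_{m=0}^M\prod_{j_1,\ldots,j_m}p(\mathcal{X}_{j_1,\ldots,j_m}\mid\mathcal{A}_{j_1,\ldots,j_m})$; equivalently $\hat p(\mathbf{x})=\prod_{i=1}^n p(x_i\mid\mathcal{C}_i)$, where the conditioning set of $x_i\in\mathcal{X}_{j_1,\ldots,j_m}$ is $\mathcal{C}_i=\mathcal{A}_{j_1,\ldots,j_m}\cup\{x_k\in\mathcal{X}_{j_1,\ldots,j_m}:k<i\}$. *)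

(* Defs.v *)
From HB Require Import structures.
From mathcomp Require Import all_boot all_order all_algebra.
From mathcomp Require Import all_classical all_reals all_analysis.

Set Implicit Arguments.
Unset Strict Implicit.
Unset Printing Implicit Defensive.

Import Order.TTheory GRing.Theory Num.Theory.

Local Open Scope ring_scope.

Definition posdefmx (R : realType) n (A : 'M[R]_n) : Prop :=
  A^T = A /\ forall v : 'cV[R]_n, v != 0 -> 0 < (v^T *m A *m v) 0 0.

Definition is_chol (R : realType) n (A B : 'M[R]_n) : Prop :=
  [/\ is_trig_mx B, forall i, 0 < B i i & B *m B^T = A].

(* A positive-definite matrix A has exactly one B such that is_chol A B, and
   chol A is that B. The value is 0 for matrices that have no such B. *)
Definition chol (R : realType) n (A : 'M[R]_n) : 'M[R]_n := xget 0 (is_chol A).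

Definition revmx (R : realType) n : 'M[R]_n :=
  \matrix_(i, j) (j == rev_ord i)%:R.

Definition rchol (R : realType) n (A : 'M[R]_n) : 'M[R]_n :=
  revmx R n *m chol (revmx R n *m A *m revmx R n) *m revmx R n.

Definition mvnormal_pdf (R : realType) n (mu : 'cV[R]_n) (S : 'M[R]_n)
    (x : 'cV[R]_n) : R :=
  (Num.sqrt ((2 * pi) ^+ n * \det S))^-1
  * expR (- ((x - mu)^T *m invmx S *m (x - mu)) 0 0 / 2).

Definition set_coord (R : realType) n (x : 'cV[R]_n) (i : 'I_n) (t : R)
    : 'cV[R]_n :=
  \col_k (if k == i then t else x k 0).

Definition integrate_out (R : realType) n (i : 'I_n) (f : 'cV[R]_n -> \bar R)
    (x : 'cV[R]_n) : \bar R :=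
  (\int[@lebesgue_measure R]_(t in setT) f (set_coord x i t))%E.

(* The density at (x_i)_(i in S) of the marginal distribution on the coordinates
   in S, when f is the joint density: the other coordinates are integrated out
   one after the other (by Tonelli's theorem the order is irrelevant). The
   result depends on x only through the coordinates in S; for S empty it is the
   total mass of f. *)
Definition marginal_pdf (R : realType) n (f : 'cV[R]_n -> R) (S : {set 'I_n})
    (x : 'cV[R]_n) : R :=
  fine (foldr (@integrate_out R n) (fun y => (f y)%:E) (enum (~: S)) x).

(* p(x_B | x_A) under the joint density f. *)
Definition cond_pdf (R : realType) n (f : 'cV[R]_n -> R) (B A : {set 'I_n})
    (x : 'cV[R]_n) : R :=
  marginal_pdf f (A :|: B) x / marginal_pdf f A x.

(* The list of all [:: j_1; ...; j_m] with 1 <= j_k <= J k for 1 <= k <= m. *)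
Fixpoint hindices (J : nat -> nat) (m : nat) : seq (seq nat) :=
  if m is m'.+1
  then [seq rcons s j | s <- hindices J m', j <- iota 1 (J m'.+1)]
  else [:: [::]].

(* A set of elements of the vector x is represented by the set of their
   positions; X [:: j_1; ...; j_m] is the set with indices j_1, ..., j_m. Only
   the values of X on lists in hindices J m with m <= M are relevant. *)
Definition level n (J : nat -> nat) (X : seq nat -> {set 'I_n}) (m : nat)
    : {set 'I_n} :=
  \bigcup_(s <- hindices J m) X s.

Record hier_partition n (M : nat) (J : nat -> nat) (X : seq nat -> {set 'I_n})
    : Prop := HierPartition {
  hier_branching : forall k, (1 <= k <= M)%N -> (1 <= J k)%N;
  hier_disjoint : forall (m1 m2 : nat) (s1 s2 : seq nat),
    (m1 <= M)%N -> (m2 <= M)%N ->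
    s1 \in hindices J m1 -> s2 \in hindices J m2 -> s1 != s2 ->
    [disjoint X s1 & X s2];
  hier_cover : \bigcup_(m < M.+1) level J X m = [set: 'I_n];
  hier_ordered : forall (m1 m2 : nat) (i j : 'I_n),
    (m1 <= M)%N -> (m2 <= M)%N ->
    (j < i)%N -> i \in level J X m1 -> j \in level J X m2 -> (m2 <= m1)%N
}.

Definition ancestors n (X : seq nat -> {set 'I_n}) (s : seq nat) : {set 'I_n} :=
  \bigcup_(k < size s) X (take k s).

(* In a hierarchical partition exactly one s contributes to the union: the one
   with i in X s. *)
Definition cond_set n (M : nat) (J : nat -> nat) (X : seq nat -> {set 'I_n})
    (i : 'I_n) : {set 'I_n} :=
  \bigcup_(m < M.+1) \bigcup_(s <- hindices J m | i \in X s)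
    (ancestors X s :|: [set k in X s | (k < i)%N]).

Definition hv_pdf (R : realType) n (p : 'cV[R]_n -> R) (M : nat)
    (J : nat -> nat) (X : seq nat -> {set 'I_n}) (x : 'cV[R]_n) : R :=
  \prod_(m < M.+1) \prod_(s <- hindices J m)
    cond_pdf p (X s) (ancestors X s) x.

(* Main.v *)
(* Each factor p(x_i | C_i) is a univariate normal density whose mean is affine in
   x_(C_i), so the HV density is that of a normal distribution with precision
   matrix A^T A, where row i of A is supported on C_i and i. The sets C_i satisfy
   C_j \subset C_i for j in C_i and only contain indices below i; thus A is lower
   triangular with positive diagonal, U = A^T, and forward substitution shows that
   L = A^-1 has the same sparsity pattern as A. *)

Require Import Defs.
From mathcomp Require Import all_boot all_order all_algebra.
From mathcomp Require Import all_classical all_reals all_analysis.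
From mathcomp Require Import ring.

Import Order.TTheory GRing.Theory Num.Theory.

Local Open Scope ring_scope.

(** * Cholesky factors and index reversal *)

(** Induction on columns: for [j <= i], entry [(i, j)] of [B *m B^T] involves only columns up to
    [j], so once the earlier columns agree it determines [B i j * B j j]; positivity settles the
    diagonal. *)
Lemma chol_unique (R : realType) n (A B C : 'M[R]_n) :
  is_chol A B -> is_chol A C -> B = C.
Proof.
move=> [Btrig Bpos BA] [Ctrig Cpos CA].
have colE (j i : 'I_n) : (j <= i)%N ->
    (forall (l k : 'I_n), (k < j)%N -> B l k = C l k) ->
    B i j * B j j = C i j * C j j.
  move=> leji eqcol.
  have := congr1 (fun Z : 'M[R]_n => Z i j) (etrans BA (esym CA)).
  rewrite !mxE (bigD1 j) //= [RHS](bigD1 j) //= !mxE.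
  suff -> : \sum_(k | k != j) B i k * B^T k j =
            \sum_(k | k != j) C i k * C^T k j by move/addIr.
  apply: eq_bigr => k nekj; rewrite !mxE.
  have [ltkj|ltjk|/ord_inj eqkj] := ltngtP k j; first by rewrite !eqcol.
    by rewrite (is_trig_mxP Btrig j k) // (is_trig_mxP Ctrig j k) // !mulr0.
  by rewrite eqkj eqxx in nekj.
suff H m (j : 'I_n) : (j < m)%N -> forall i, B i j = C i j.
  by apply/matrixP => i j; apply: (H j.+1).
elim: m j => // m IH j ltjm i.
have eqcol (l k : 'I_n) : (k < j)%N -> B l k = C l k.
  by move=> ltkj; apply: IH; apply: leq_trans ltkj _.
have [ltij|leji] := ltnP i j.
  by rewrite (is_trig_mxP Btrig) // (is_trig_mxP Ctrig).
have dE : B j j = C j j.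
  apply/eqP; rewrite -(@eqrXn2 _ 2) ?ltW //; apply/eqP; rewrite !expr2.
  exact: colE.
have := colE j i leji eqcol; rewrite dE => /mulIf; apply.
by rewrite gt_eqF.
Qed.

Lemma cholE (R : realType) n (A B : 'M[R]_n) : is_chol A B -> chol A = B.
Proof.
move=> AB; apply: xget_unique => // C CP; exact: chol_unique CP AB.
Qed.

Lemma mul_revmxE (R : realType) n (A : 'M[R]_n) i j :
  (revmx R n *m A *m revmx R n) i j = A (rev_ord i) (rev_ord j).
Proof.
rewrite !mxE (bigD1 (rev_ord j)) //= !mxE (bigD1 (rev_ord i)) //= !mxE.
rewrite rev_ordK !eqxx mul1r mulr1 !big1 ?addr0 // => k /negbTE nek; rewrite !mxE.
  have -> : (j == rev_ord k) = false.
    by apply/eqP => jE; rewrite jE rev_ordK eqxx in nek.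
  by rewrite mulr0.
by rewrite nek mul0r.
Qed.

Lemma revmxK (R : realType) n : revmx R n *m revmx R n = 1%:M.
Proof.
apply/matrixP => i j; rewrite -{1}[revmx R n]mulmx1 mul_revmxE !mxE.
by rewrite (inj_eq rev_ord_inj).
Qed.

Lemma tr_revmx (R : realType) n : (revmx R n)^T = revmx R n.
Proof.
apply/matrixP => i j; rewrite !mxE.
by rewrite -[i in LHS]rev_ordK (inj_eq rev_ord_inj) eq_sym.
Qed.

(** Conjugation by [revmx] reverses both index orders, so the upper triangular [U] becomes a lower
    triangular matrix with positive diagonal, hence the Cholesky factor. *)
Lemma rcholE (R : realType) n (U : 'M[R]_n) :
  is_trig_mx U^T -> (forall i, 0 < U i i) -> rchol (U *m U^T) = U.
Proof.
move=> Utrig Upos; set P := revmx R n.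
have PP : P *m P = 1%:M := revmxK R n.
rewrite /rchol (@cholE _ _ _ (P *m U *m P)).
  by rewrite !mulmxA PP mul1mx -mulmxA PP mulmx1.
split.
- apply/is_trig_mxP => i j ltij; rewrite mul_revmxE.
  have := is_trig_mxP Utrig (rev_ord j) (rev_ord i); rewrite mxE; apply => /=.
  by apply: ltn_sub2l => //; apply: leq_ltn_trans ltij (ltn_ord j).
- by move=> i; rewrite mul_revmxE.
- rewrite !trmx_mul tr_revmx -/P !mulmxA.
  by rewrite -(mulmxA (P *m U) P P) PP mulmx1.
Qed.

(** * Gram matrices and supports of triangular inverses *)

Lemma posdefmx_gram (R : realType) n (A : 'M[R]_n) :
  A \in unitmx -> posdefmx (A^T *m A).
Proof.
move=> Aunit; split=> [|v v0]; first by rewrite trmx_mul trmxK.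
have -> : v^T *m (A^T *m A) *m v = (A *m v)^T *m (A *m v).
  by rewrite trmx_mul !mulmxA.
rewrite mxE lt_neqAle eq_sym; apply/andP; split; last first.
  by apply: sumr_ge0 => i _; rewrite mxE -expr2 sqr_ge0.
apply: contra v0 => /eqP sum0.
rewrite -[v](mulKmx Aunit) (_ : A *m v = 0) ?mulmx0 //.
apply/colP => i; rewrite [RHS]mxE; apply/eqP; rewrite -sqrf_eq0.
have /psumr_eq0P/(_ sum0) /(_ i isT) : forall j : 'I_n, true ->
    0 <= (A *m v)^T 0 j * (A *m v) j 0.
  by move=> j _; rewrite mxE -expr2 sqr_ge0.
by rewrite mxE -expr2 => ->.
Qed.

(* Forward substitution: the inverse of a lower triangular matrix only fills in
   positions reachable along its nonzero entries, and [C] is transitive. *)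
Lemma trig_inv_support (R : realType) n (C : 'I_n -> {set 'I_n})
    (A V : 'M[R]_n)
    (Clt : forall i j, j \in C i -> (j < i)%N)
    (Ctrans : forall i j k, j \in C i -> k \in C j -> k \in C i)
    (Asupp : forall i j, i != j -> j \notin C i -> A i j = 0)
    (A0 : forall i, A i i != 0) (AV : A *m V = 1%:M) :
  (forall i j, i != j -> j \notin C i -> V i j = 0) /\
  (forall i, V i i = (A i i)^-1).
Proof.
have rowE i j : A i i * V i j + \sum_(k in C i) A i k * V k j = (i == j)%:R.
  have := congr1 (fun Z : 'M[R]_n => Z i j) AV; rewrite !mxE => <-.
  rewrite [RHS](bigD1 i) //=; congr (_ + _).
  rewrite [RHS](bigID (mem (C i))) /= [X in _ + X]big1 ?addr0; last first.
    by move=> k /andP[ki kC]; rewrite Asupp ?mul0r // eq_sym.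
  apply: eq_bigl => k; rewrite andbC; case: (boolP (k \in C i)) => //= kC.
  by apply/esym/eqP => ki; have := Clt _ _ kC; rewrite ki ltnn.
have off m (i : 'I_n) : (i < m)%N ->
    forall j, i != j -> j \notin C i -> V i j = 0.
  elim: m i => // m IH i ltim j neij jC.
  have := rowE i j; rewrite (negbTE neij) big1 ?addr0.
    by move/eqP; rewrite mulf_eq0 (negbTE (A0 i)) => /eqP.
  move=> k kC; rewrite IH ?mulr0 //.
  - by apply: leq_trans (Clt _ _ kC) _.
  - by apply: contra jC => /eqP <-.
  - by apply: contra jC; apply: Ctrans.
split=> [i j|i]; first exact: (off i.+1).
have := rowE i i; rewrite eqxx big1 ?addr0 => [AVi|k kC].
  by apply: (mulfI (A0 i)); rewrite AVi divff.
have ltki := Clt _ _ kC.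
rewrite (off k.+1) ?mulr0 //; first by rewrite neq_ltn ltki.
by apply/negP => /Clt /ltn_trans/(_ ltki); rewrite ltnn.
Qed.

(** * Marginal covariance and precision matrices *)

Definition indmx (R : realType) n (S : {set 'I_n}) : 'M[R]_n :=
  diag_mx (\row_i (i \in S)%:R).

(* The covariance of the coordinates in S, extended by the identity to the other
   coordinates; this keeps all the marginals in the same matrix type. Locked, since
   unification would otherwise unfold it to match matrix products and entries. *)
Definition marg_cov (R : realType) n (Sigma : 'M[R]_n) (S : {set 'I_n}) :
    'M[R]_n :=
  locked (indmx R n S *m Sigma *m indmx R n S + (1%:M - indmx R n S)).

(* The inverse of the covariance of the coordinates in S, extended by zero. *)
Definition marg_prec (R : realType) n (Sigma : 'M[R]_n) (S : {set 'I_n}) :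
    'M[R]_n :=
  locked (invmx (marg_cov R n Sigma S) *m indmx R n S).

Lemma tr_indmx (R : realType) n (S : {set 'I_n}) :
  (indmx R n S)^T = indmx R n S.
Proof. exact: tr_diag_mx. Qed.

Lemma indmx_idem (R : realType) n (S : {set 'I_n}) :
  indmx R n S *m indmx R n S = indmx R n S.
Proof.
rewrite /indmx mulmx_diag; congr diag_mx; apply/rowP => i.
by rewrite !mxE -natrM mulnb andbb.
Qed.

Lemma indmx_setT (R : realType) n : indmx R n [set: 'I_n] = 1%:M.
Proof. by apply/matrixP => i j; rewrite !mxE inE. Qed.

Lemma indmxD1 (R : realType) n (S : {set 'I_n}) (i : 'I_n) : i \in S ->
  indmx R n (S :\ i) = indmx R n S - delta_mx i i.
Proof.
move=> iS; apply/matrixP => k l; rewrite !mxE in_setD1.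
have [->|nekl] := eqVneq k l; last first.
  rewrite !mulr0n; case: eqP => [ki|_]; last by rewrite subr0.
  by rewrite -ki eq_sym (negbTE nekl) subr0.
by rewrite !mulr1n; case: eqP => [->|_] /=; rewrite ?iS ?subrr ?subr0.
Qed.

Lemma mul_indmx_delta (R : realType) n (S : {set 'I_n}) (i : 'I_n) p (j : 'I_p) :
  i \in S -> indmx R n S *m delta_mx i j = delta_mx i j.
Proof.
move=> iS; rewrite mul_diag_mx; apply/matrixP => k l; rewrite !mxE.
by case: eqP => [->|_]; rewrite ?iS ?mul1r ?mulr0.
Qed.

Lemma marg_covE (R : realType) n (Sigma : 'M[R]_n) (S : {set 'I_n}) i j :
  marg_cov R n Sigma S i j =
  if (i \in S) && (j \in S) then Sigma i j else (i == j)%:R.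
Proof.
rewrite /marg_cov -lock /indmx mul_diag_mx mul_mx_diag !mxE.
have [->|nij] := eqVneq i j; rewrite ?mulr1n ?mulr0n.
  by case: (j \in S) => /=; rewrite ?mul1r ?mulr1 ?mul0r ?subrr ?subr0 ?addr0 ?add0r.
by case: (i \in S); case: (j \in S);
   rewrite /= ?mul1r ?mulr1 ?mul0r ?mulr0 ?subrr ?addr0.
Qed.

Lemma marg_cov_setT (R : realType) n (Sigma : 'M[R]_n) :
  marg_cov R n Sigma [set: 'I_n] = Sigma.
Proof. by apply/matrixP => i j; rewrite marg_covE !inE. Qed.

Lemma marg_prec_setT (R : realType) n (Sigma : 'M[R]_n) :
  marg_prec R n Sigma [set: 'I_n] = invmx Sigma.
Proof. by rewrite /marg_prec -lock marg_cov_setT indmx_setT mulmx1. Qed.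

Lemma marg_cov_sym (R : realType) n (Sigma : 'M[R]_n) (S : {set 'I_n}) :
  Sigma^T = Sigma -> (marg_cov R n Sigma S)^T = marg_cov R n Sigma S.
Proof.
move=> symS; rewrite /marg_cov -lock !raddfD /= raddfN /= trmx1 !trmx_mul tr_indmx symS.
by rewrite mulmxA.
Qed.

(** A left kernel vector [v] vanishes outside [S], where the padding acts as the identity; on [S]
    the entries of [v *m Sigma] vanish too, so [v *m Sigma *m v^T = 0], against positive
    definiteness. *)
Lemma marg_cov_unit (R : realType) n (Sigma : 'M[R]_n) (S : {set 'I_n}) :
  posdefmx Sigma -> marg_cov R n Sigma S \in unitmx.
Proof.
move=> [symS posS]; rewrite -row_free_unit -kermx_eq0; apply: contraT.
case/rowV0Pn => v /sub_kermxP vB v0.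
suff : (v *m Sigma *m v^T) 0 0 = 0.
  have := posS v^T; rewrite trmxK trmx_eq0 => /(_ v0) /[swap] ->.
  by rewrite ltxx.
have vS j : j \notin S -> v 0 j = 0.
  move=> jS; have := congr1 (fun w : 'rV[R]_n => w 0 j) vB; rewrite !mxE => vBj.
  rewrite -[RHS]vBj (bigD1 j) //= marg_covE (negbTE jS) andbF eqxx mulr1.
  by rewrite big1 ?addr0 // => k kj; rewrite marg_covE (negbTE jS) andbF
    (negbTE kj) mulr0.
rewrite mxE big1 // => j _; rewrite [_^T _ _]mxE.
have [jS|jS] := boolP (j \in S); last by rewrite (vS _ jS) mulr0.
suff -> : (v *m Sigma) 0 j = 0 by rewrite mul0r.
have := congr1 (fun w : 'rV[R]_n => w 0 j) vB.
rewrite [RHS]mxE => vBj; rewrite -[RHS]vBj !mxE; apply: eq_bigr => k _.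
rewrite marg_covE jS andbT.
by case: ifPn => // kS; rewrite vS // !mul0r.
Qed.

(** The common value shows that the padded covariance, and hence its inverse, commutes with the
    projection onto [S]. *)
Lemma marg_covC (R : realType) n (Sigma : 'M[R]_n) (S : {set 'I_n}) :
  indmx R n S *m marg_cov R n Sigma S = indmx R n S *m Sigma *m indmx R n S /\
  marg_cov R n Sigma S *m indmx R n S = indmx R n S *m Sigma *m indmx R n S.
Proof.
rewrite /marg_cov -!lock mulmxDr mulmxDl mulmxBr mulmxBl mulmx1 mul1mx indmx_idem subrr.
by rewrite !addr0 !mulmxA indmx_idem -!mulmxA indmx_idem.
Qed.

Section MargPrec.
Context {R : realType} {n : nat} {Sigma : 'M[R]_n} (hS : posdefmx Sigma).
Implicit Types (S : {set 'I_n}) (i : 'I_n).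
Local Notation D := (indmx R n).
Local Notation B := (marg_cov R n Sigma).
Local Notation Q := (marg_prec R n Sigma).

Lemma indmx_invC S : D S *m invmx (B S) = invmx (B S) *m D S.
Proof.
have Bu : B S \in unitmx := marg_cov_unit _ _ _ S hS.
have [DB BD] := marg_covC _ _ Sigma S.
by rewrite -[D S in LHS](mulKmx Bu) BD -DB !mulmxA mulmxK.
Qed.

Lemma marg_precD S : Q S *m D S = Q S.
Proof. by rewrite /marg_prec -lock -mulmxA indmx_idem. Qed.

Lemma marg_precDl S : D S *m Q S = Q S.
Proof. by rewrite /marg_prec -lock mulmxA indmx_invC -mulmxA indmx_idem. Qed.

Lemma marg_prec_sym S : (Q S)^T = Q S.
Proof.
rewrite /marg_prec -lock trmx_mul tr_indmx trmx_inv marg_cov_sym; last by case: hS.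
exact: indmx_invC.
Qed.

Lemma marg_prec_cov S : Q S *m Sigma *m D S = D S.
Proof.
have Bu : B S \in unitmx := marg_cov_unit _ _ _ S hS.
have [DB BD] := marg_covC _ _ Sigma S.
by rewrite /marg_prec -lock -!mulmxA (mulmxA (D S)) -BD mulKmx.
Qed.

Lemma marg_cov_prec S : D S *m Sigma *m Q S = D S.
Proof.
have [symS _] := hS.
by apply: trmx_inj; rewrite !trmx_mul tr_indmx marg_prec_sym symS mulmxA
  marg_prec_cov.
Qed.

(* This makes the order in which coordinates are integrated out irrelevant. *)
Lemma marg_prec_unique S (A : 'M[R]_n) :
  A *m D S = A -> A *m Sigma *m D S = D S -> A = Q S.
Proof.
move=> AD AS; rewrite -AD -{1}marg_cov_prec !mulmxA AD -{1}marg_precDl mulmxA AS.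
exact: marg_precDl.
Qed.

(** Column [q] of [Q S] satisfies [q^T *m Sigma *m q = Q S i i], and it is nonzero because
    [D S *m Sigma] sends it to the basis vector [i]. *)
Lemma marg_prec_gt0 S i : i \in S -> 0 < Q S i i.
Proof.
move=> iS; set q : 'cV[R]_n := Q S *m delta_mx i 0.
have q0 : q != 0.
  apply/eqP => q0; have : D S *m Sigma *m q = 0 by rewrite q0 mulmx0.
  rewrite /q mulmxA marg_cov_prec mul_indmx_delta //.
  move/matrixP/(_ i 0); rewrite !mxE !eqxx => /eqP.
  by rewrite oner_eq0.
have [_ /(_ q q0)] := hS; congr (0 < _).
rewrite /q trmx_mul marg_prec_sym -!mulmxA (mulmxA Sigma) (mulmxA (Q S)).
rewrite -{2}marg_precDl (mulmxA Sigma) !mulmxA.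
rewrite -(mulmxA _ (Q S) Sigma) -(mulmxA _ _ (D S)) marg_prec_cov.
rewrite -(mulmxA _ (D S)) marg_precDl trmx_delta -rowE -colE.
by rewrite !mxE.
Qed.

(** Schur complement formula for dropping a coordinate in precision form; the right-hand side is
    checked against the two equations of [marg_prec_unique]. *)
Lemma marg_precD1 S i : i \in S ->
  Q (S :\ i) = Q S - (Q S i i)^-1 *: (Q S *m delta_mx i i *m Q S).
Proof.
move=> iS; have Qi := marg_prec_gt0 _ _ iS.
set E : 'M[R]_n := delta_mx i i.
have DE : D (S :\ i) = D S - E := indmxD1 _ _ _ _ iS.
have EQE : E *m Q S *m E = Q S i i *: E.
  rewrite /E -(mul_delta_mx (0 : 'I_1)) !mulmxA -(mulmxA _ _ (Q S)) -rowE.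
  rewrite -(mulmxA _ _ (delta_mx i 0)) -colE.
  rewrite [col i _]mx11_scalar !mxE mul_mx_scalar.
  by rewrite scalemxAl.
have DD : D S *m D (S :\ i) = D (S :\ i).
  by rewrite DE mulmxBr indmx_idem mul_indmx_delta.
have ED : E *m D (S :\ i) = 0.
  have EDS : E *m D S = E.
    by apply: trmx_inj; rewrite trmx_mul tr_indmx trmx_delta mul_indmx_delta.
  by rewrite DE mulmxBr EDS mul_delta_mx subrr.
symmetry; apply: marg_prec_unique.
  rewrite DE mulmxBr !mulmxBl -!scalemxAl -(mulmxA _ _ (D S)) !marg_precD.
  have -> : Q S *m E *m Q S *m E = Q S i i *: (Q S *m E).
    by rewrite -!mulmxA (mulmxA E) EQE -scalemxAr.
  rewrite scalerA.
  by rewrite mulVf ?gt_eqF // scale1r subrr subr0.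
(* Inserting [D S] lets [marg_prec_cov] for [S] apply; the rank-one term then dies by [ED]. *)
rewrite -DD mulmxA; set Q' := (_ - _).
have -> : Q' *m Sigma *m D S = D S - (Q S i i)^-1 *: (Q S *m E *m D S).
  by rewrite !mulmxBl -!scalemxAl marg_prec_cov -!(mulmxA (Q S *m E)) marg_prec_cov.
by rewrite mulmxBl -scalemxAl -(mulmxA _ (D S)) DD -(mulmxA _ E) ED mulmx0 scaler0
  subr0.
Qed.

(** Cramer's rule: [Q S i i] is a cofactor of [B S] over its determinant, and removing [i] from [S]
    makes row [i] a unit row without changing that minor. *)
Lemma det_marg_covD1 S i : i \in S ->
  \det (B (S :\ i)) = Q S i i * \det (B S).
Proof.
move=> iS; have Bu : B S \in unitmx := marg_cov_unit _ _ _ S hS.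
have -> : Q S i i = (\det (B S))^-1 * cofactor (B S) i i.
  rewrite /marg_prec -lock /indmx mul_mx_diag !mxE iS mulr1 /invmx Bu !mxE.
  by [].
rewrite mulrC mulrA divff ?mul1r; last by rewrite -unitfE.
rewrite (expand_det_row _ i) (bigD1 i) //= big1 => [|j ji]; last first.
  by rewrite marg_covE !inE eqxx /= eq_sym (negbTE ji) mul0r.
rewrite marg_covE !inE !eqxx /= mul1r addr0 /cofactor; congr (_ * \det _).
apply/matrixP => k l; rewrite !mxE !marg_covE !inE.
by rewrite eq_sym neq_lift eq_sym neq_lift.
Qed.

Lemma det_marg_cov_gt0 S : 0 < \det (B S).
Proof.
move: {2}#|S| (erefl #|S|) => m; elim: m S => [|m IH] S cS.
  have -> : B S = 1%:M.
    by apply/matrixP => i j; rewrite marg_covE (cards0_eq cS) !inE !mxE.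
  by rewrite det1.
have [i iS] : exists i, i \in S by apply/card_gt0P; rewrite cS.
have := IH (S :\ i); rewrite det_marg_covD1 // pmulr_rgt0 ?marg_prec_gt0 //.
by apply; move: cS; rewrite (cardsD1 i) iS => -[].
Qed.

End MargPrec.

(** * Gaussian marginals by integrating out coordinates *)

Definition qform (R : realType) n (A : 'M[R]_n) (y : 'cV[R]_n) : R :=
  (y^T *m A *m y) 0 0.

(** Closed form of the marginal density: padding by the identity preserves the determinant of the
    [S] block, and padding the precision by zero removes the other coordinates from the exponent. *)
Definition gauss_marg (R : realType) n (mu : 'cV[R]_n) (Sigma : 'M[R]_n)
    (S : {set 'I_n}) (x : 'cV[R]_n) : R :=
  (Num.sqrt ((2 * pi) ^+ #|S| * \det (marg_cov R n Sigma S)))^-1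
  * expR (- qform R n (marg_prec R n Sigma S) (x - mu) / 2).

Lemma gauss_marg_setT (R : realType) n (mu : 'cV[R]_n) (Sigma : 'M[R]_n) x :
  gauss_marg R n mu Sigma [set: 'I_n] x = mvnormal_pdf mu Sigma x.
Proof.
by rewrite /gauss_marg marg_cov_setT marg_prec_setT cardsT card_ord.
Qed.

Section GaussMarg.
Context {R : realType} {n : nat} {mu : 'cV[R]_n} {Sigma : 'M[R]_n}.
Context (hS : posdefmx Sigma).
Implicit Types (S : {set 'I_n}) (i : 'I_n) (x y : 'cV[R]_n).
Local Notation D := (indmx R n).
Local Notation B := (marg_cov R n Sigma).
Local Notation Q := (marg_prec R n Sigma).
Local Notation g := (gauss_marg R n mu Sigma).

Lemma gauss_marg_gt0 S x : 0 < g S x.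
Proof.
rewrite mulr_gt0 ?expR_gt0 // invr_gt0 sqrtr_gt0 mulr_gt0 ?det_marg_cov_gt0 //.
by rewrite exprn_gt0 // mulr_gt0 ?pi_gt0.
Qed.

(** Completing the square: the rank-one term of [marg_precD1] is the square of a single linear
    form. *)
Lemma qform_margD1 S i y : i \in S ->
  qform R n (Q S) y =
  qform R n (Q (S :\ i)) y + ((Q S *m y) i 0) ^+ 2 / Q S i i.
Proof.
move=> iS; rewrite marg_precD1 // /qform mulmxBr mulmxBl.
rewrite -scalemxAr -scalemxAl [X in _ = X + _]mxE [X in _ = _ + X + _]mxE.
rewrite [X in _ = _ - X + _]mxE.
suff -> : (y^T *m (Q S *m delta_mx i i *m Q S) *m y) 0 0 = ((Q S *m y) i 0) ^+ 2.
  by rewrite mulrC subrK.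
rewrite -(mul_delta_mx (0 : 'I_1)) !mulmxA -(mulmxA _ (delta_mx 0 i)).
rewrite -(mulmxA _ _ y) -(mulmxA (delta_mx 0 i)) -rowE.
have -> : y^T *m Q S *m delta_mx i 0 = (row i (Q S *m y))^T.
  by rewrite [row _ _]rowE !trmx_mul trmx_delta (marg_prec_sym hS).
by rewrite mxE big_ord1 !mxE expr2.
Qed.

(* The last factor is the conditional density of coordinate [i] given the
   coordinates in [S :\ i]. *)
Lemma gauss_margD1 S i x : i \in S ->
  g S x = g (S :\ i) x * (Num.sqrt (Q S i i / (2 * pi)) *
    expR (- ((Q S *m (x - mu)) i 0) ^+ 2 / (2 * Q S i i))).
Proof.
move=> iS; have Qi := marg_prec_gt0 hS _ _ iS.
have pi2 : 0 < 2 * pi :> R by rewrite mulr_gt0 ?pi_gt0.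
rewrite /gauss_marg (qform_margD1 _ _ _ iS) (det_marg_covD1 hS _ _ iS).
move: (2 * pi) pi2 => c c0.
rewrite mulrACA -expRD; congr (_ * expR _); last first.
  by field; rewrite gt_eqF.
rewrite [#|S|](cardsD1 i) iS /=; set m := #|_|.
have dS := det_marg_cov_gt0 hS S.
rewrite add1n exprS.
have -> : c ^+ m * (Q S i i * \det (B S)) =
    (c * c ^+ m * \det (B S)) * (Q S i i / c).
  by field; rewrite gt_eqF.
rewrite [in RHS]sqrtrM; last first.
  by rewrite ltW // !mulr_gt0 // exprn_gt0.
by rewrite invfM divfK // gt_eqF // sqrtr_gt0 divr_gt0.
Qed.

Lemma set_coordE x i t :
  set_coord x i t = x + (t - x i 0) *: delta_mx i 0.
Proof.
apply/colP => k; rewrite !mxE eqxx andbT.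
by case: eqP => [->|_]; rewrite ?mulr1 ?mulr0 ?addr0 // addrC subrK.
Qed.

Lemma gauss_marg_set_coord S i x t : i \notin S ->
  g S (set_coord x i t) = g S x.
Proof.
move=> iS; rewrite /gauss_marg.
suff -> : qform R n (Q S) (set_coord x i t - mu) = qform R n (Q S) (x - mu) by [].
have qD y : qform R n (Q S) y = qform R n (Q S) (D S *m y).
  rewrite /qform trmx_mul tr_indmx !mulmxA.
  by rewrite -(mulmxA _ (D S) (Q S)) (marg_precDl hS) -(mulmxA _ (Q S) (D S)) marg_precD.
rewrite qD [RHS]qD.
suff -> : D S *m (set_coord x i t - mu) = D S *m (x - mu) by [].
apply/colP => k; rewrite /indmx !mul_diag_mx !mxE.
by case: eqP => [->|//]; rewrite (negbTE iS) !mul0r.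
Qed.

(** Coordinate [i] of [Q S *m (x - mu)] is affine in [x i 0] with slope [Q S i i], which gives the
    variance [(Q S i i)^-1]. The mean, although written with [x i 0], does not depend on it. *)
Lemma gauss_marg_normal S i x t : i \in S ->
  g S (set_coord x i t) = g (S :\ i) x *
    normal_pdf (x i 0 - (Q S *m (x - mu)) i 0 / Q S i i)
               (Num.sqrt (Q S i i))^-1 t.
Proof.
move=> iS; have Qi := marg_prec_gt0 hS _ _ iS.
rewrite (gauss_margD1 _ _ _ iS) gauss_marg_set_coord ?setD11 //; congr (_ * _).
have sQ : Num.sqrt (Q S i i) != 0 by rewrite gt_eqF // sqrtr_gt0.
rewrite normal_pdfE ?invr_eq0 // /normal_peak /normal_fun.
have sQ2 : (Num.sqrt (Q S i i))^-1 ^+ 2 = (Q S i i)^-1.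
  by rewrite exprVn sqr_sqrtr // ltW.
rewrite sQ2; congr (_ * expR _).
  rewrite -sqrtrV; last by rewrite mulrn_wge0 // mulr_ge0 ?pi_ge0 ?invr_ge0 // ltW.
  have := pi_gt0 R; move: pi => c c0.
  by congr Num.sqrt; field; rewrite !gt_eqF.
have -> : (Q S *m (set_coord x i t - mu)) i 0 =
    (Q S *m (x - mu)) i 0 + (t - x i 0) * Q S i i.
  rewrite set_coordE addrAC mulmxDr mxE; congr (_ + _).
  by rewrite -scalemxAr -colE !mxE.
by field; rewrite gt_eqF.
Qed.

Lemma integrate_out_gauss_marg S i x : i \in S ->
  integrate_out i (fun y => (g S y)%:E) x = (g (S :\ i) x)%:E.
Proof.
move=> iS; rewrite /integrate_out.
under eq_integral => t _ do rewrite gauss_marg_normal // EFinM.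
by rewrite integralZl ?integral_normal_pdf ?mule1 //; exact: integrable_normal_pdf.
Qed.

Lemma marginal_pdf_gauss S x :
  marginal_pdf (mvnormal_pdf mu Sigma) S x = g S x.
Proof.
rewrite /marginal_pdf.
(* The list is generalized so that induction follows [foldr]: integrating out [s] leaves the
   marginal on its complement. *)
suff H (s : seq 'I_n) : uniq s ->
    foldr (@integrate_out R n) (fun y => (mvnormal_pdf mu Sigma y)%:E) s =
    (fun y => (g [set k | k \notin s] y)%:E).
  rewrite H ?enum_uniq //=; congr (g _ x).
  by apply/setP => k; rewrite inE mem_enum inE negbK.
elim: s => [_|i s IH /= /andP[nis us]] /=; apply/funext => y.
  by rewrite -gauss_marg_setT; congr (g _ _)%:E; apply/setP => k; rewrite !inE.
rewrite IH // integrate_out_gauss_marg ?inE //; congr (g _ _)%:E.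
by apply/setP => k; rewrite !inE negb_or.
Qed.

End GaussMarg.

Lemma marg_prec_out (R : realType) n (Sigma : 'M[R]_n) (S : {set 'I_n}) i k :
  k \notin S -> marg_prec R n Sigma S i k = 0.
Proof.
move=> kS; rewrite -marg_precD /indmx mul_mx_diag !mxE.
by rewrite (negbTE kS) mulr0.
Qed.

(** * Chain rule and combinatorics of the hierarchy *)

(** Chain rule for densities: the elements of [B] join the conditioning set one at a time in
    increasing order, and the ratios telescope. *)
Lemma prod_ratio_set (F : fieldType) n (h : {set 'I_n} -> F) (A B : {set 'I_n}) :
  (forall S, h S != 0) ->
  h (A :|: B) / h A =
  \prod_(i in B) (h (i |: (A :|: [set k in B | (k < i)%N])) /
                  h (A :|: [set k in B | (k < i)%N])).
Proof.
move=> h0; pose f (m : nat) := h (A :|: [set k in B | (k < m)%N]).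
have telescope m : \prod_(k < m) (f k.+1 / f k) = f m / f 0%N.
  elim: m => [|m IH]; first by rewrite big_ord0 divff //; apply: h0.
  by rewrite big_ord_recr /= IH mulrC mulrA divfK //; apply: h0.
have -> : h (A :|: B) / h A = f n / f 0%N.
  congr (h _ / h _); apply/setP => k; rewrite !inE ?ltn_ord ?andbT //.
  by rewrite andbF orbF.
rewrite -telescope [RHS]big_mkcond /=; apply: eq_bigr => i _.
case: ifPn => iB; last first.
  suff -> : f i.+1 = f i by rewrite divff //; apply: h0.
  congr h; apply/setP => k; rewrite !inE ltnS leq_eqVlt.
  by case: (eqVneq (k : nat) i) => //= /ord_inj ->; rewrite (negbTE iB).
congr (h _ / _); apply/setP => k; rewrite !inE ltnS leq_eqVlt.
have [->|nki] := eqVneq k i; first by rewrite eqxx iB /= orbT.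
by rewrite (inj_eq (@ord_inj n)) (negbTE nki).
Qed.

Lemma mem_bigcup_seq (I : eqType) (T : finType) (r : seq I) (F : I -> {set T}) x :
  reflect (exists2 i, i \in r & x \in F i) (x \in \bigcup_(i <- r) F i).
Proof.
elim: r => [|j r IH]; first by rewrite big_nil inE; constructor; case.
rewrite big_cons finset.in_setU; apply: (iffP orP) => [[xj|/IH[i ir xi]]|[i]].
- by exists j; rewrite ?mem_head.
- by exists i; rewrite // in_cons ir orbT.
- rewrite in_cons => /predU1P[-> xj|ir xi]; first by left.
  by right; apply/IH; exists i.
Qed.

Lemma size_hindices J m s : s \in hindices J m -> size s = m.
Proof.
elim: m s => [|m IH] s /=; first by rewrite inE => /eqP ->.
by case/allpairsP => -[t j] [/= /IH st _ ->]; rewrite size_rcons st.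
Qed.

Lemma uniq_hindices J m : uniq (hindices J m).
Proof.
elim: m => //= m IH; apply: allpairs_uniq => //; first exact: iota_uniq.
by move=> [s j] [t k] _ _ /= /rcons_inj [-> ->].
Qed.

Lemma take_hindices J m k s :
  (k <= m)%N -> s \in hindices J m -> take k s \in hindices J k.
Proof.
elim: m s => [|m IH] s.
  by rewrite leqn0 => /eqP -> _; rewrite take0 inE.
rewrite leq_eqVlt => /orP[/eqP -> sm|ltkm /=].
  by rewrite take_oversize ?(size_hindices _ _ _ sm).
case/allpairsP => -[t j] [/= tm _ ->].
by rewrite -cats1 takel_cat ?(size_hindices _ _ _ tm) // IH.
Qed.

Section Hierarchy.
Context {n M : nat} {J : nat -> nat} {X : seq nat -> {set 'I_n}}.
Context (hX : hier_partition M J X).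

Definition in_block (i : 'I_n) (s : seq nat) : Prop :=
  [/\ (size s <= M)%N, s \in hindices J (size s) & i \in X s].

Lemma mem_level m s i : s \in hindices J m -> i \in X s -> i \in level J X m.
Proof. by move=> sm iX; apply/mem_bigcup_seq; exists s. Qed.

Lemma block_ex i : exists s, in_block i s.
Proof.
have : i \in [set: 'I_n] by rewrite inE.
rewrite -(hier_cover hX) => /bigcupP[m _ /mem_bigcup_seq[s sm iX]].
exists s.
by rewrite /in_block (size_hindices _ _ _ sm) sm -ltnS ltn_ord.
Qed.

Lemma block_unique i s m t : in_block i s ->
  (m <= M)%N -> t \in hindices J m -> i \in X t -> t = s.
Proof.
move=> [sM sJ iXs] mM tJ iXt; apply/eqP; apply: contraT => nts.
by rewrite (disjointFr (hier_disjoint hX mM sM tJ sJ nts) iXt) in iXs.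
Qed.

(** Only the block of [i] passes the filter. The monoid law is abstract in order to serve both
    unions in [cond_setE] and products in [hv_pdf_prod]. *)
Lemma big_block (T : Type) (idx : T) (op : Monoid.com_law idx) i s F :
  in_block i s ->
  \big[op/idx]_(m < M.+1) \big[op/idx]_(t <- hindices J m | i \in X t) F t = F s.
Proof.
move=> is_s; have [sM sJ iX] := is_s.
have tE m t : (m < M.+1)%N -> t \in hindices J m -> i \in X t -> t = s.
  by move=> mM; apply: block_unique is_s mM.
pose ms := Ordinal (sM : (size s < M.+1)%N).
rewrite (bigD1 ms) //= [X in op _ X]big1 ?Monoid.mulm1 => [|m nm]; last first.
  rewrite big1_seq // => t /andP[iXt tm]; case/eqP: nm; apply: val_inj => /=.
  by rewrite -(tE m t) // (size_hindices _ _ _ tm).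
rewrite big_mkcond (bigD1_seq s) ?uniq_hindices //= iX.
rewrite big1_seq ?Monoid.mulm1 // => t /andP[nts tm].
by case: ifPn => // iXt; rewrite (tE _ _ _ tm) ?eqxx ?ltnS // in nts.
Qed.

Lemma cond_setE i s : in_block i s ->
  cond_set M J X i = ancestors X s :|: [set k in X s | (k < i)%N].
Proof. by move=> is_s; rewrite /cond_set (big_block _ _ _ _ s). Qed.

Lemma in_block_take i s k j : in_block i s -> (k < size s)%N ->
  j \in X (take k s) -> in_block j (take k s).
Proof.
move=> [sM sJ _] ks jX; have sk : size (take k s) = k by rewrite size_takel // ltnW.
rewrite /in_block sk jX (take_hindices _ _ _ _ (ltnW ks) sJ).
by rewrite (leq_trans (ltnW ks) sM).
Qed.

(** Inside a block this is part of the definition; an ancestor block lies on a strictly lower level,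
    so the compatible ordering applies. *)
Lemma cond_set_lt i j : j \in cond_set M J X i -> (j < i)%N.
Proof.
have [s is_s] := block_ex i; rewrite (cond_setE _ _ is_s) finset.in_setU.
case/orP => [/bigcupP[[k ks] _ /= jX]|]; last by rewrite inE => /andP[].
have [sM sJ iX] := is_s.
have [tM tJ _] := in_block_take _ _ _ _ is_s ks jX.
have sk : size (take k s) = k by rewrite size_takel // ltnW.
rewrite sk in tM tJ.
have [//|ltij|/ord_inj ji] := ltngtP j i.
  have := hier_ordered hX tM sM ltij (mem_level _ _ _ tJ jX)
    (mem_level _ _ _ sJ iX).
  by rewrite leqNgt ks.
(* The case [j = i] would put [i] in two blocks whose index lists have different lengths. *)
rewrite ji in jX; have := block_unique _ _ _ _ is_s tM tJ jX.
by move=> ts; rewrite -ts sk ltnn in ks.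
Qed.

(** Ancestors of an ancestor come from shorter prefixes of the same index list, and [cond_set]
    contains each ancestor block as a whole. Elements of one block share their ancestors. *)
Lemma cond_set_trans i j k :
  j \in cond_set M J X i -> k \in cond_set M J X j -> k \in cond_set M J X i.
Proof.
have [s is_s] := block_ex i; rewrite (cond_setE _ _ is_s) finset.in_setU.
have [sM sJ _] := is_s.
case/orP => [/bigcupP[[l ls] _ /= jX]|].
  have jt := in_block_take _ _ _ _ is_s ls jX.
  rewrite (cond_setE _ _ jt) finset.in_setU => kC.
  rewrite finset.in_setU; apply/orP; left.
  case/orP: kC => [/bigcupP[[p pl] _ /=]|]; last first.
    rewrite inE => /andP[kX _]; apply/bigcupP.
    by exists (Ordinal ls).
  have ltpl : (p < l)%N by move: pl; rewrite size_takel // ltnW.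
  rewrite take_takel ?(ltnW ltpl) // => kX; apply/bigcupP.
  by exists (Ordinal (ltn_trans ltpl ls)).
rewrite inE => /andP[jX ltji].
have js : in_block j s by [].
rewrite (cond_setE _ _ js) !inE => /orP[->//|/andP[-> ltkj]].
by rewrite (ltn_trans ltkj ltji) orbT.
Qed.

(** Chain rule inside each block, then an exchange of products to index them by coordinates; nonzero
    marginals justify the telescoping. *)
Lemma hv_pdf_prod (R : realType) (p : 'cV[R]_n -> R) (x : 'cV[R]_n) :
  (forall S, marginal_pdf p S x != 0) ->
  hv_pdf p M J X x = \prod_i cond_pdf p [set i] (cond_set M J X i) x.
Proof.
move=> p0; rewrite /hv_pdf.
pose C (i : 'I_n) s := ancestors X s :|: [set k in X s | (k < i)%N].
pose r i s := marginal_pdf p (i |: C i s) x / marginal_pdf p (C i s) x.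
transitivity (\prod_i \prod_(m < M.+1)
    \prod_(s <- hindices J m | i \in X s) r i s); last first.
  apply: eq_bigr => i _; have [s is_s] := block_ex i.
  by rewrite (big_block _ _ _ _ s) // /r /cond_pdf (cond_setE _ _ is_s) finset.setUC.
rewrite exchange_big /=; apply: eq_bigr => m _.
rewrite (exchange_big_dep xpredT) //=; apply: eq_bigr => s _.
exact: (prod_ratio_set _ _ (fun S => marginal_pdf p S x)).
Qed.

End Hierarchy.

(** * Assembly of the approximating normal density *)

(** The quadratic form is the squared norm of [A *m (x - mu)], and [\det A] is the product of the
    diagonal, so the density splits row by row. *)
Lemma mvnormal_pdf_factor (R : realType) n (mu : 'cV[R]_n) (A : 'M[R]_n) x :
  is_trig_mx A -> (forall i, 0 < A i i) ->
  mvnormal_pdf mu (invmx (A^T *m A)) x =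
  \prod_i ((Num.sqrt (2 * pi))^-1 * A i i *
           expR (- ((A *m (x - mu)) i 0) ^+ 2 / 2)).
Proof.
move=> Atrig Apos; set y := x - mu.
have detA : 0 < \det A by rewrite det_trig // prodr_gt0.
rewrite !big_split /= -det_trig // prodr_const card_ord -expR_sum.
rewrite /mvnormal_pdf invmxK -/y; congr (_ * expR _); last first.
  rewrite !mulmxA -trmx_mul -mulmxA [X in - X](_ : _ = \sum_i ((A *m y) i 0) ^+ 2).
    by rewrite -sumrN mulr_suml.
  by rewrite mxE; apply: eq_bigr => i _; rewrite mxE expr2.
rewrite det_inv det_mulmx det_tr.
have -> : (2 * pi) ^+ n * (\det A * \det A)^-1 =
    (Num.sqrt (2 * pi) ^+ n / \det A) ^+ 2 :> R.
  have pi2 : 0 <= 2 * pi :> R by rewrite mulr_ge0 ?pi_ge0.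
  by rewrite -{1}(sqr_sqrtr pi2) [RHS]exprMn exprVn -expr2 -!exprM mulnC.
rewrite sqrtr_sqr ger0_norm; last first.
  by rewrite divr_ge0 ?exprn_ge0 ?sqrtr_ge0 // ltW.
by rewrite invfM invrK exprVn.
Qed.

Theorem proposition1 (R : realType) (n : nat) (mu : 'cV[R]_n) (Sigma : 'M[R]_n)
    (M : nat) (J : nat -> nat) (X : seq nat -> {set 'I_n})
    (hSigma : posdefmx Sigma) (hX : hier_partition M J X) :
  exists Sigmahat : 'M[R]_n,
    [/\ posdefmx Sigmahat,
        forall x : 'cV[R]_n,
          hv_pdf (mvnormal_pdf mu Sigma) M J X x = mvnormal_pdf mu Sigmahat x
      & let L := chol Sigmahat in
        let U := rchol (invmx Sigmahat) in
        (forall i j : 'I_n, i != j ->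
           (j \notin cond_set M J X i -> L i j = 0) /\
           (j \notin cond_set M J X i -> U j i = 0)) /\
        U = (invmx L)^T].
Proof.
pose C := cond_set M J X.
have Clt i j : j \in C i -> (j < i)%N := cond_set_lt hX i j.
have Ctrans i j k : j \in C i -> k \in C j -> k \in C i := cond_set_trans hX i j k.
pose Q i := marg_prec R n Sigma (i |: C i).
(* The scaling makes [(A *m (x - mu)) i 0] the residual of coordinate [i] given [C i], divided by
   its conditional standard deviation. *)
pose A : 'M[R]_n := \matrix_(i, k) (Q i i k / Num.sqrt (Q i i i)).
have Qpos i : 0 < Q i i i by apply: marg_prec_gt0 => //; rewrite setU11.
have Adiag i : A i i = Num.sqrt (Q i i i).
  by rewrite mxE -{1}(sqr_sqrtr (ltW (Qpos i))) expr2 mulfK // gt_eqF // sqrtr_gt0.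
have Apos i : 0 < A i i by rewrite Adiag sqrtr_gt0.
have Asupp i j : i != j -> j \notin C i -> A i j = 0.
  move=> nij jC; rewrite mxE /Q marg_prec_out ?mul0r //.
  by rewrite !inE negb_or eq_sym nij.
have Atrig : is_trig_mx A.
  apply/is_trig_mxP => i j ltij; apply: Asupp; first by rewrite neq_ltn ltij.
  by apply/negP => /Clt; rewrite ltnNge ltnW.
have Aunit : A \in unitmx.
  by rewrite unitmxE det_trig // unitfE gt_eqF // prodr_gt0.
pose V := invmx A.
have AV : A *m V = 1%:M by rewrite mulmxV.
have [Vsupp Vdiag] := trig_inv_support _ _ _ _ _ Clt Ctrans Asupp
  (fun i => lt0r_neq0 (Apos i)) AV.
have SE : invmx (A^T *m A) = V *m V^T.
  have AAu : A^T *m A \in unitmx by rewrite unitmx_mul unitmx_tr Aunit.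
  rewrite -[RHS](mulKmx AAu) -!mulmxA (mulmxA A) AV mul1mx -trmx_mul.
  by rewrite mulVmx // trmx1 mulmx1.
have cholV : chol (V *m V^T) = V.
  apply: cholE; split=> //; last by move=> i; rewrite Vdiag invr_gt0.
  apply/is_trig_mxP => i j ltij; apply: Vsupp; first by rewrite neq_ltn ltij.
  by apply/negP => /Clt; rewrite ltnNge ltnW.
exists (invmx (A^T *m A)); split.
- rewrite SE -{1}[V]trmxK; apply: posdefmx_gram.
  by rewrite unitmx_tr unitmx_inv.
- move=> x; have g0 := gauss_marg_gt0 hSigma.
  rewrite (hv_pdf_prod hX) => [|S]; last first.
    by rewrite marginal_pdf_gauss // gt_eqF // gauss_marg_gt0.
  rewrite mvnormal_pdf_factor //; apply: eq_bigr => i _.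
  rewrite /cond_pdf !marginal_pdf_gauss // finset.setUC -/(C i).
  (* The marginal on [i |: C i] is split so that the one on [C i] cancels and the univariate
     conditional factor remains. *)
  rewrite (gauss_margD1 hSigma _ i) ?setU11 // setU1K; last first.
    by apply/negP => /Clt; rewrite ltnn.
  rewrite mulrAC divff ?mul1r ?gt_eqF ?gauss_marg_gt0 // -/(Q i) Adiag.
  have -> : (A *m (x - mu)) i 0 = (Q i *m (x - mu)) i 0 / Num.sqrt (Q i i i).
    by rewrite !mxE mulr_suml; apply: eq_bigr => k _; rewrite mxE mulrAC.
  rewrite sqrtrM ?(ltW (Qpos i)) // sqrtrV ?mulr_ge0 ?pi_ge0 //.
  rewrite [X in X * expR _]mulrC; congr (_ * expR _).
  by rewrite expr_div_n sqr_sqrtr ?(ltW (Qpos i)) // invfM mulNr mulrA mulNr mulrAC.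
- rewrite /= SE cholV -SE !invmxK.
  (* The precision is [U *m U^T] with [U = A^T], so [U j i = A i j] inherits the support of [A]. *)
  have -> : rchol (A^T *m A) = A^T.
    by rewrite -{2}[A]trmxK rcholE ?trmxK // => i; rewrite mxE.
  split=> // i j nij; split=> jC; first exact: Vsupp.
  by rewrite mxE Asupp.
Qed.
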